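(* Let $H$ be a Hopf algebra over a field $\Bbbk$ with bijective antipode $S$ and let $(A,\rho_A)$ be a right $H$-comodule algebra. The map $$\underline{B}:H\otimes H\to A\otimes H^{\mathrm{op}},\qquad \underline{B}(h\otimes h')=1_A\otimes h'S^{-1}(h)$$ (product taken in $H$) is a normalized Casimir morphism for $(H,\psi)$. Equivalently, the map $$\underline{\mathfrak{T}}:H\to A\otimes H^{\mathrm{op}},\qquad \underline{\mathfrak{T}}(h)=\underline{B}(h\otimes 1_H)=1_A\otimes S^{-1}(h)$$ is a total integral on $(H,\psi)$.
   Context: Everything is over a field $\Bbbk$, $\otimes=\otimes_{\Bbbk}$, and Sweedler notation with suppressed summation is used. $H$ is a Hopf algebra with counit $\varepsilon$ and antipode $S$; $H^{\mathrm{op}}$ is $H$ with opposite multiplication. A right $H$-comodule algebra $(A,\rho_A)$ is a unital associative algebra $A$ which is a right $H$-comodule via an algebra map $\rho_A:A\to A\otimes H$, $\rho_A(a)=a_0\otimes a_1$ (iterated: $a_0\otimes a_1\otimes a_2$, etc.). With $\psi:H\otimes A\otimes H^{\mathrm{op}}\to A\otimes H^{\mathrm{op}}\otimes H$, $\psi(h\otimes a\otimes l)=a_0\otimes l_1\otimes l_2ha_1$, one has a cowreath $(A\otimes H^{\mathrm{op}},H,\psi)$. Convention: whenever a multiplication symbol is omitted, products in $A\otimes H$ are computed with the ordinary multiplications of $A$ and of $H$ (not the opposite one). A Casimir morphism for $(H,\psi)$ is a $\Bbbk$-linear map $B:H\otimes H\to A\otimes H^{\mathrm{op}}$, written $B(h\otimes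 h')=B^A(h\otimes h')\otimes B^H(h\otimes h')$, such that for all $a\in A$, $g,h,h'\in H$: $$(a_0\otimes 1_H)B(g_2ha_1\otimes g_3h'a_2)(1_A\otimes g_1)=(1_A\otimes g)B(h\otimes h')(a\otimes 1_H),$$ $$B^A(h_2\otimes h')_0\otimes B^H(h_2\otimes h')_1\otimes B^H(h_2\otimes h')_2h_1B^A(h_2\otimes h')_1=B(h\otimes h'_1)\otimes h'_2.$$ It is normalized if $B(h_1\otimes h_2)=\varepsilon(h)1_A\otimes 1_H$ for all $h\in H$. An integral on $(H,\psi)$ is a $\Bbbk$-linear map $\mathfrak{T}:H\to A\otimes H^{\mathrm{op}}$, written $\mathfrak{T}(h)=\mathfrak{T}^A(h)\otimes \mathfrak{T}^H(h)$, such that for all $a\in A$, $h\in H$: $$\mathfrak{T}^A(h_2)_0\otimes \mathfrak{T}^H(h_2)_1\otimes \mathfrak{T}^H(h_2)_2h_1\mathfrak{T}^A(h_2)_1=\mathfrak{T}(h)\otimes 1_H,$$ $$(a_0\otimes 1_H)\mathfrak{T}(S^{-1}(a_2)ha_1)(1_A\otimes S^{-1}(a_3))=(1_A\otimes S^{-1}(a_1))\mathfrak{T}(h)(a_0\otimes 1_H).$$ It is total if $\mathfrak{T}(1_H)=1_A\otimes 1_H$. (''Equivalently'' refers to the correspondence $B\mapsto B(-\otimes 1_H)$ between normalized Casimir morphisms and total integrals.) *)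

(* Defs.v *)
From HB Require Import structures.
From mathcomp Require Import all_boot all_order all_algebra.
From mathcomp Require Import boolp.
From mathcomp Require classical_sets.
From mathcomp Require Import finmap monalg.

Set Implicit Arguments.
Unset Strict Implicit.
Unset Printing Implicit Defensive.

Import GRing.Theory.
Local Open Scope ring_scope.
Local Open Scope quotient_scope.

Reserved Notation "V ⊗ W" (at level 45, left associativity).
Reserved Notation "\sw_ ( v ⊗ w <- t ) E"
  (at level 49, v name, w name, t at level 100, E at level 49, right associativity,
   format "'[' \sw_ ( v  ⊗  w  <-  t ) '/  '  E ']'").

(* V ⊗ W is the free k-module on the pairs (v, w), modulo the span of the
   bilinearity relators. *)
Section Tensor.
Context (k : fieldType) (V W : lmodType k).

Inductive tensor_relator : {malg k[(V * W)%type]} -> Prop :=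
| RelatorDl v v' w :
    tensor_relator (<< (v + v', w) >> - << (v, w) >> - << (v', w) >>)
| RelatorDr v w w' :
    tensor_relator (<< (v, w + w') >> - << (v, w) >> - << (v, w') >>)
| RelatorZl c v w : tensor_relator (<< (c *: v, w) >> - c *: << (v, w) >>)
| RelatorZr c v w : tensor_relator (<< (v, c *: w) >> - c *: << (v, w) >>).

Inductive relator_span : {malg k[(V * W)%type]} -> Prop :=
| RelatorSpan0 : relator_span 0
| RelatorSpanD c r x :
    tensor_relator r -> relator_span x -> relator_span (c *: r + x).

Definition tensor_ker (x : {malg k[(V * W)%type]}) : bool := `[< relator_span x >].

Lemma relator_spanD x y :
  relator_span x -> relator_span y -> relator_span (x + y).
Proof.
move=> + sy; elim=> [|c r z rr _ IH]; first by rewrite add0r.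
by rewrite -addrA; apply: RelatorSpanD.
Qed.

Lemma relator_spanZ c x : relator_span x -> relator_span (c *: x).
Proof.
elim=> [|d r z rr _ IH]; first by rewrite scaler0; apply: RelatorSpan0.
by rewrite scalerDr scalerA; apply: RelatorSpanD.
Qed.

Lemma relator_span1 r : tensor_relator r -> relator_span r.
Proof.
move=> rr; rewrite -[r]addr0 -[r in r + _]scale1r.
exact: RelatorSpanD RelatorSpan0.
Qed.

Lemma tensor_ker_submod : submod_closed tensor_ker.
Proof.
split=> [|c x y]; first exact/asboolP/RelatorSpan0.
move=> /asboolP sx /asboolP sy; apply/asboolP.
by apply: relator_spanD => //; apply: relator_spanZ.
Qed.

HB.instance Definition _ :=
  GRing.isSubmodClosed.Build k {malg k[(V * W)%type]} tensor_ker tensor_ker_submod.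

Definition tensor : Type := 
  Quotient.quot (HB.pack_for (zmodClosed {malg k[(V * W)%type]}) tensor_ker).

HB.instance Definition _ := GRing.Zmodule.on tensor.
HB.instance Definition _ := EqQuotient.on tensor.

Lemma tensor_pi_eq (x y : {malg k[(V * W)%type]}) :
  \pi_tensor x = \pi_tensor y <-> relator_span (x - y).
Proof.
split=> [/eqP|s]; first by rewrite -Quotient.idealrBE => /asboolP.
by apply/eqP; rewrite -Quotient.idealrBE; apply/asboolP.
Qed.

Lemma tensor_piB : zmod_morphism \pi_tensor.
Proof. by move=> x y; rewrite /tensor !piE. Qed.

HB.instance Definition _ :=
  GRing.isZmodMorphism.Build {malg k[(V * W)%type]} tensor \pi_tensor tensor_piB.

Definition tensor_scale (c : k) (t : tensor) : tensor :=
  \pi_tensor (c *: repr t).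

Lemma tensor_scale_pi c x : tensor_scale c (\pi x) = \pi_tensor (c *: x).
Proof.
apply/tensor_pi_eq; rewrite -scalerBr; apply: relator_spanZ.
by apply/tensor_pi_eq; rewrite reprK.
Qed.

Lemma tensor_scaleA a b t :
  tensor_scale a (tensor_scale b t) = tensor_scale (a * b) t.
Proof. by rewrite -[t]reprK !tensor_scale_pi scalerA. Qed.

Lemma tensor_scale1 : left_id 1 tensor_scale.
Proof. by move=> t; rewrite -[t]reprK tensor_scale_pi scale1r. Qed.

Lemma tensor_scaleDr : right_distributive tensor_scale +%R.
Proof.
move=> c s t; rewrite -[s]reprK -[t]reprK -raddfD !tensor_scale_pi.
by rewrite scalerDr raddfD.
Qed.

Lemma tensor_scaleDl t : {morph tensor_scale^~ t : a b / a + b}.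
Proof. by move=> a b; rewrite -[t]reprK !tensor_scale_pi scalerDl raddfD. Qed.

HB.instance Definition _ := GRing.Zmodule_isLmodule.Build k tensor
  tensor_scaleA tensor_scale1 tensor_scaleDr tensor_scaleDl.

Lemma tensor_piZ : scalable \pi_tensor.
Proof. by move=> c x; rewrite -tensor_scale_pi. Qed.

HB.instance Definition _ :=
  GRing.isScalable.Build k {malg k[(V * W)%type]} tensor *:%R \pi_tensor tensor_piZ.

End Tensor.

Arguments tensor {k} V%_type W%_type.
Notation "V ⊗ W" := (tensor V W) : type_scope.

HB.lock Definition tens (k : fieldType) (V W : lmodType k) (v : V) (w : W) : V ⊗ W :=
  \pi_(V ⊗ W)%type << (v, w) >>.

(* Sweedler's summation: the sum of f v w over an expression of t as a linear
   combination of the v ⊗ w.  It depends on the chosen expression unless f is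
   bilinear, in which case it is the linear map induced by f: see sweedlerE and
   sweedler_linear. *)
HB.lock Definition sweedler (k : fieldType) (V W U : lmodType k)
    (f : V -> W -> U) (t : V ⊗ W) : U :=
  \sum_(p <- msupp (repr t)) (repr t)@_p *: f p.1 p.2.

Arguments tens {k V W} v%_R w%_R.
Arguments sweedler {k V W U} f%_function t%_R.

Notation "v ⊗ w" := (tens v w) : ring_scope.
Notation "\sw_ ( v ⊗ w <- t ) E" := (sweedler (fun v w => E) t) : ring_scope.

Section TensorTheory.
Context (k : fieldType) (V W : lmodType k).

Local Lemma subr_split (Z : zmodType) (a b c d : Z) :
  a - (d + b) = (a - c - b) + (c - d).
Proof. by rewrite opprD addrA [a - c - b]addrAC addrA subrK addrAC. Qed.

Lemma tens_is_bilinear : bilinear_for *:%R *:%R (@tens k V W).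
Proof.
split=> [w c u v|v c u w]; rewrite -[RHS]/(_ + _) tens.unlock -linearZ -raddfD;
  apply/tensor_pi_eq.
- rewrite (subr_split _ _ << (c *: u, w) >>).
  by apply: relator_spanD; apply: relator_span1;
    [apply: RelatorDl | apply: RelatorZl].
- rewrite (subr_split _ _ << (v, c *: u) >>).
  by apply: relator_spanD; apply: relator_span1;
    [apply: RelatorDr | apply: RelatorZr].
Qed.

Lemma tensPl w : linear (@tens k V W ^~ w).
Proof. exact: tens_is_bilinear.1. Qed.

Lemma tensPr v : linear (@tens k V W v).
Proof. exact: tens_is_bilinear.2. Qed.

Lemma tensDl u v w : tens (u + v) w = tens u w + tens v w :> V ⊗ W.
Proof. by have := tensPl w 1 u v; rewrite /= !scale1r. Qed.

Lemma tensDr v u w : tens v (u + w) = tens v u + tens v w :> V ⊗ W.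
Proof. by have := tensPr v 1 u w; rewrite /= !scale1r. Qed.

Lemma tens0l w : tens 0 w = 0 :> V ⊗ W.
Proof. by apply: (addrI (tens 0 w)); rewrite -tensDl !addr0. Qed.

Lemma tens0r v : tens v 0 = 0 :> V ⊗ W.
Proof. by apply: (addrI (tens v 0)); rewrite -tensDr !addr0. Qed.

Lemma tensZl c v w : tens (c *: v) w = c *: tens v w :> V ⊗ W.
Proof. by have := tensPl w c v 0; rewrite /= addr0 tens0l addr0. Qed.

Lemma tensZr c v w : tens v (c *: w) = c *: tens v w :> V ⊗ W.
Proof. by have := tensPr v c w 0; rewrite /= addr0 tens0r addr0. Qed.

Lemma tensor_ind (P : V ⊗ W -> Prop) :
  (forall v w, P (tens v w)) -> (forall s t, P s -> P t -> P (s + t)) ->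
  forall t, P t.
Proof.
move=> Pt PD t; rewrite -[t]reprK [repr t]monalgE raddf_sum.
apply: (big_ind P) => [||[v w] _ /=]; [by rewrite -(tens0l 0)|exact: PD|].
have -> : << (repr t)@_(v, w) *g (v, w) >>
        = (repr t)@_(v, w) *: << (v, w) >> :> {malg k[(V * W)%type]}.
  by apply/malgP=> p; rewrite mcoeffZ !mcoeffU mulrnAr mulr1.
rewrite linearZ /=; set p := (X in _ *: X).
have -> : p = tens v w by rewrite /p tens.unlock.
rewrite -tensZl; exact: Pt.
Qed.

Section Sweedler.
Context (U : lmodType k).

Let lift (f : V -> W -> U) (x : {malg k[(V * W)%type]}) : U :=
  \sum_(p <- msupp x) x@_p *: f p.1 p.2.

Local Lemma liftEw f (d : {fset (V * W)}%fset) x : (msupp x `<=` d)%fset ->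
  lift f x = \sum_(p <- d) x@_p *: f p.1 p.2.
Proof.
move=> xd; rewrite /lift; apply: big_fset_incl => // p _ pNx.
by rewrite mcoeff_outdom ?scale0r.
Qed.

Local Lemma lift_is_linear f : linear (lift f).
Proof.
move=> c x y; pose d := (msupp (c *: x + y) `|` (msupp x `|` msupp y))%fset.
have d1 : (msupp (c *: x + y) `<=` d)%fset by exact: fsubsetUl.
have d2 : (msupp x `<=` d)%fset.
  by rewrite fsubsetU // fsubsetUl orbT.
have d3 : (msupp y `<=` d)%fset.
  by rewrite fsubsetU // fsubsetUr orbT.
rewrite (liftEw f d1) (liftEw f d2) (liftEw f d3).
rewrite scaler_sumr -big_split /=; apply: eq_bigr => p _.
by rewrite mcoeffD mcoeffZ scalerDl scalerA.
Qed.

Local Lemma liftB f x y : lift f (x - y) = lift f x - lift f y.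
Proof.
have -> : x - y = -1 *: y + x by rewrite scaleN1r addrC.
by rewrite lift_is_linear scaleN1r addrC.
Qed.

Local Lemma lift1 f v w : lift f << (v, w) >> = f v w.
Proof.
rewrite /lift msuppU oner_eq0 big_seq_fset1 mcoeffUU.
by rewrite scale1r.
Qed.

Variable f : V -> W -> U.
Hypothesis f_bilinear : bilinear_for *:%R *:%R f.

Local Lemma lift_relator r : tensor_relator r -> lift f r = 0.
Proof.
have lZ c x : lift f (c *: x) = c *: lift f x.
  by rewrite -[c *: x]addr0 lift_is_linear /lift msupp0 big_seq_fset0 addr0.
have fDl u v w : f (u + v) w = f u w + f v w.
  by have := f_bilinear.1 w 1 u v; rewrite /= !scale1r.
have fDr u v w : f u (v + w) = f u v + f u w.
  by have := f_bilinear.2 u 1 v w; rewrite /= !scale1r.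
have f0l w : f 0 w = 0 by apply: (addrI (f 0 w)); rewrite -fDl !addr0.
have f0r v : f v 0 = 0 by apply: (addrI (f v 0)); rewrite -fDr !addr0.
have fZl c v w : f (c *: v) w = c *: f v w.
  by have := f_bilinear.1 w c v 0; rewrite /= addr0 f0l addr0.
have fZr c v w : f v (c *: w) = c *: f v w.
  by have := f_bilinear.2 v c w 0; rewrite /= addr0 f0r addr0.
case=> *; rewrite !liftB ?lZ !lift1.
- by rewrite fDl addrAC addrK subrr.
- by rewrite fDr addrAC addrK subrr.
- by rewrite fZl subrr.
- by rewrite fZr subrr.
Qed.

Local Lemma lift_span x : relator_span x -> lift f x = 0.
Proof.
elim=> [|c r y rr _ IH]; first by rewrite /lift msupp0 big_seq_fset0.
by rewrite lift_is_linear lift_relator // IH scaler0 addr0.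
Qed.

Local Lemma sweedler_pi x : sweedler f (\pi x) = lift f x.
Proof.
apply/eqP; rewrite -subr_eq0 sweedler.unlock -[X in X - _]/(lift f _); apply/eqP.
rewrite -liftB; apply: lift_span.
by apply/tensor_pi_eq; rewrite reprK.
Qed.

Lemma sweedlerE v w : sweedler f (tens v w) = f v w.
Proof. by rewrite tens.unlock sweedler_pi lift1. Qed.

Lemma sweedler_linear : linear (sweedler f).
Proof.
move=> c s t; rewrite -[s]reprK -[t]reprK -linearP !sweedler_pi.
exact: lift_is_linear.
Qed.

Lemma sweedlerD s t : sweedler f (s + t) = sweedler f s + sweedler f t.
Proof. by have := sweedler_linear 1 s t; rewrite !scale1r. Qed.

Lemma sweedlerZ c t : sweedler f (c *: t) = c *: sweedler f t.
Proof.
have s0 : sweedler f 0 = 0.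
  by apply: (addrI (sweedler f 0)); rewrite -sweedlerD !addr0.
by rewrite -[c *: t]addr0 sweedler_linear s0 addr0.
Qed.

End Sweedler.
End TensorTheory.

(* The axiom 1 != 0 of the algebra A ⊗ B rests on the following functionals. *)
Lemma functional_exists (k : fieldType) (V : lmodType k) (v : V) :
  v != 0 -> exists2 f : V -> k, scalar f & f v = 1.
Proof.
move=> v0; pose P (X : V -> Prop) :=
  (forall c x y, X x -> X y -> X (c *: x + y)) /\ ~ X v.
have [F FP Ftot|A [[AL Av] Amax]] := @classical_sets.Zorn_bigcup V P.
  split=> [c x y [X FX Xx] [Y FY Yy]|[X FX Xv]]; last by case: (FP X FX).
  have [XY|YX] := Ftot X Y FX FY.
  - by exists Y => //; apply: (FP Y FY).1 => //; apply: XY.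
  - by exists X => //; apply: (FP X FX).1 => //; apply: YX.
have A0 : A 0.
  apply: contrapT => nA0; apply: (Amax (fun x => x = 0)).
    split=> [x Ax|/(_ 0 erefl)//].
    by case: nA0; have := AL (-1) x x Ax Ax; rewrite scaleN1r addNr.
  by split=> [c x y -> ->|/eqP]; [rewrite scaler0 addr0|rewrite (negPf v0)].
have ex u : exists c, A (u - c *: v).
  have [Au|nAu] := pselect (A u); first by exists 0; rewrite scale0r subr0.
  apply: contrapT => nex.
  apply: (Amax (fun x => exists2 a, A a & exists c, x = a + c *: u)).
    split=> [x Ax|/(_ u)]; first by exists x => //; exists 0; rewrite scale0r addr0.
    by move=> H; apply/nAu/H; exists 0 => //; exists 1; rewrite scale1r add0r.
  split=> [c x y [a Aa [d ->]] [b Ab [e ->]]|[a Aa [c vE]]].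
    exists (c *: a + b); first exact: AL.
    by exists (c * d + e); rewrite scalerDr scalerDl scalerA addrACA.
  have [c0|c0] := eqVneq c 0.
    by apply: Av; rewrite vE c0 scale0r addr0.
  apply: nex; exists c^-1; rewrite vE scalerDr scalerA mulVf // scale1r.
  by rewrite opprD addrA addrAC subrr sub0r -scaleNr -[_ *: a]addr0; apply: AL.
have uniqc u c d : A (u - c *: v) -> A (u - d *: v) -> c = d.
  move=> Ac Ad; apply/eqP; rewrite -subr_eq0; apply/negPn/negP => cd.
  apply: Av; have := AL (d - c)^-1 _ _ (AL (-1) _ _ Ad Ac) A0.
  rewrite scaleN1r opprB addrA subrK -scalerBl addr0 scalerA mulVf ?scale1r //.
  by rewrite subr_eq0 eq_sym -subr_eq0.
pose f u := projT1 (cid (ex u)); have fP u : A (u - f u *: v) := projT2 (cid (ex u)).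
exists f => [c x y|]; apply: uniqc (fP _) _; last by rewrite scale1r subrr.
rewrite scalerDl -scalerA opprD addrACA -scalerBr; exact: AL.
Qed.

Lemma tens_neq0 (k : fieldType) (V W : lmodType k) (v : V) (w : W) :
  v != 0 -> w != 0 -> tens v w != 0.
Proof.
move=> /functional_exists[f lf fv] /functional_exists[g lg gw].
pose h x y : k^o := f x * g y.
have hb : bilinear_for *:%R *:%R h.
  split=> x c y z /=; rewrite /h.
    by rewrite lf mulrDl -mulrA.
  by rewrite lg mulrDr mulrCA.
apply: contraNneq (oner_neq0 k) => vw0.
have := sweedlerE hb v w; rewrite vw0 /h fv gw mulr1 => <-.
by have := sweedlerZ hb 0 0; rewrite !scale0r => ->.
Qed.

HB.lock Definition tensor_mul (k : fieldType) (A B : algType k) (s t : A ⊗ B) : A ⊗ B :=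
  \sw_(a ⊗ b <- s) \sw_(a' ⊗ b' <- t) (a * a') ⊗ (b * b').

Section TensorAlgebra.
Context (k : fieldType) (A B : algType k).
Local Notation tensor_mul := (@tensor_mul k A B).

Local Lemma mul_inner_bilinear (a : A) (b : B) :
  bilinear_for *:%R *:%R (fun a' b' => (a * a') ⊗ (b * b')).
Proof.
by split=> ? c u v /=; rewrite mulrDr -scalerAr ?tensPl ?tensPr.
Qed.

Local Lemma mul_outer_bilinear (t : A ⊗ B) : bilinear_for *:%R *:%R
  (fun (a : A) (b : B) => \sw_(a' ⊗ b' <- t) (a * a') ⊗ (b * b')).
Proof.
split=> x c u v /=; elim/tensor_ind: t => [a' b'|s t IHs IHt].
- rewrite !(sweedlerE (mul_inner_bilinear _ _)).
  by rewrite mulrDl -scalerAl tensPl.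
- by rewrite !(sweedlerD (mul_inner_bilinear _ _)) IHs IHt scalerDr addrACA.
- rewrite !(sweedlerE (mul_inner_bilinear _ _)).
  by rewrite mulrDl -scalerAl tensPr.
- by rewrite !(sweedlerD (mul_inner_bilinear _ _)) IHs IHt scalerDr addrACA.
Qed.

Local Lemma tensor_mul_tensl a b (t : A ⊗ B) :
  tensor_mul (a ⊗ b) t = \sw_(a' ⊗ b' <- t) (a * a') ⊗ (b * b').
Proof. by rewrite tensor_mul.unlock (sweedlerE (mul_outer_bilinear t)). Qed.

Lemma tensor_mulE a b a' b' :
  tensor_mul (a ⊗ b) (a' ⊗ b') = (a * a') ⊗ (b * b').
Proof.
rewrite tensor_mul_tensl.
exact: (sweedlerE (mul_inner_bilinear _ _)).
Qed.

Lemma tensor_mulDl : left_distributive tensor_mul +%R.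
Proof. by move=> s s' t; rewrite tensor_mul.unlock (sweedlerD (mul_outer_bilinear t)). Qed.

Lemma tensor_mulZl c s t : tensor_mul (c *: s) t = c *: tensor_mul s t.
Proof. by rewrite tensor_mul.unlock (sweedlerZ (mul_outer_bilinear t)). Qed.

Lemma tensor_mulDr : right_distributive tensor_mul +%R.
Proof.
move=> s t t'; elim/tensor_ind: s => [a b|s s' IHs IHs'].
  rewrite !tensor_mul_tensl.
  exact: (sweedlerD (mul_inner_bilinear _ _)).
by rewrite !tensor_mulDl IHs IHs' addrACA.
Qed.

Lemma tensor_mulZr c s t : tensor_mul s (c *: t) = c *: tensor_mul s t.
Proof.
elim/tensor_ind: s => [a b|s s' IHs IHs'].
  rewrite !tensor_mul_tensl.
  exact: (sweedlerZ (mul_inner_bilinear _ _)).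
by rewrite !tensor_mulDl IHs IHs' scalerDr.
Qed.

Lemma tensor_mulA : associative tensor_mul.
Proof.
move=> r s t; elim/tensor_ind: r => [a b|r r' IH IH']; last first.
  by rewrite !tensor_mulDl IH IH'.
elim/tensor_ind: s => [a' b'|s s' IH IH']; last first.
  by rewrite !(tensor_mulDl, tensor_mulDr) IH IH'.
elim/tensor_ind: t => [a'' b''|t t' IH IH']; last first.
  by rewrite !tensor_mulDr IH IH'.
by rewrite !tensor_mulE !mulrA.
Qed.

Lemma tensor_mul1 : left_id (1 ⊗ 1) tensor_mul.
Proof.
move=> t; elim/tensor_ind: t => [a b|s t IHs IHt].
  by rewrite tensor_mulE !mul1r.
by rewrite tensor_mulDr IHs IHt.
Qed.

Lemma tensor_mulr1 : right_id (1 ⊗ 1) tensor_mul.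
Proof.
move=> t; elim/tensor_ind: t => [a b|s t IHs IHt].
  by rewrite tensor_mulE !mulr1.
by rewrite tensor_mulDl IHs IHt.
Qed.

HB.instance Definition _ := GRing.Zmodule_isNzRing.Build (A ⊗ B)%type
  tensor_mulA tensor_mul1 tensor_mulr1 tensor_mulDl tensor_mulDr
  (tens_neq0 (oner_neq0 A) (oner_neq0 B)).

HB.instance Definition _ := GRing.Lmodule_isLalgebra.Build k (A ⊗ B)%type
  (fun c s t => esym (tensor_mulZl c s t)).
HB.instance Definition _ := GRing.Lalgebra_isAlgebra.Build k (A ⊗ B)%type
  (fun c s t => esym (tensor_mulZr c s t)).

Lemma tens1 : 1 ⊗ 1 = 1 :> A ⊗ B.
Proof. by []. Qed.

Lemma tensM a a' b b' : (a ⊗ b) * (a' ⊗ b') = (a * a') ⊗ (b * b') :> A ⊗ B.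
Proof. exact: tensor_mulE. Qed.

End TensorAlgebra.

HB.mixin Record isCoalgebra (k : fieldType) C of GRing.Lmodule k C := {
  comul : C -> C ⊗ C;
  counit : C -> k;
  comul_linear : linear comul;
  counit_scalar : scalar counit;
  comulA : forall c : C,
    \sw_(c1 ⊗ c2 <- comul c) (comul c1 ⊗ c2) =
    \sw_(c1 ⊗ c2 <- comul c) \sw_(c3 ⊗ c4 <- comul c2) (c1 ⊗ c3 ⊗ c4);
  counitl : forall c : C, \sw_(c1 ⊗ c2 <- comul c) counit c1 *: c2 = c;
  counitr : forall c : C, \sw_(c1 ⊗ c2 <- comul c) counit c2 *: c1 = c
}.

#[short(type="coalgType")]
HB.structure Definition Coalgebra (k : fieldType) :=
  {C of isCoalgebra k C & GRing.Lmodule k C}.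

HB.mixin Record isBialgebra (k : fieldType) H
    of GRing.Algebra k H & Coalgebra k H := {
  comul_monoid_morphism : monoid_morphism (comul : H -> H ⊗ H);
  counit_monoid_morphism : monoid_morphism (counit : H -> k)
}.

#[short(type="bialgType")]
HB.structure Definition Bialgebra (k : fieldType) :=
  {H of isBialgebra k H & GRing.Algebra k H & Coalgebra k H}.

HB.mixin Record isHopfAlgebra (k : fieldType) H of Bialgebra k H := {
  antipode : H -> H;
  antipode_linear : linear antipode;
  antipodel : forall h : H,
    \sw_(h1 ⊗ h2 <- comul h) (antipode h1 * h2) = counit h *: 1;
  antipoder : forall h : H,
    \sw_(h1 ⊗ h2 <- comul h) (h1 * antipode h2) = counit h *: 1
}.

#[short(type="hopfAlgType")]
HB.structure Definition HopfAlgebra (k : fieldType) :=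
  {H of isHopfAlgebra k H & Bialgebra k H}.

Record comodule_algebra (k : fieldType) (H : bialgType k) (A : algType k)
    (rho : A -> A ⊗ H) : Prop := {
  coaction_linear : linear rho;
  coaction_monoid_morphism : monoid_morphism rho;
  coactionA : forall a,
    \sw_(a0 ⊗ a1 <- rho a) (rho a0 ⊗ a1) =
    \sw_(a0 ⊗ a1 <- rho a) \sw_(a2 ⊗ a3 <- comul a1) (a0 ⊗ a2 ⊗ a3);
  coaction_counit : forall a, \sw_(a0 ⊗ a1 <- rho a) counit a1 *: a0 = a
}.

(* As a vector space A ⊗ H^op is A ⊗ H, and every product below is the one of
   the algebra A ⊗ H; so H^op does not appear.  Iterated coactions and
   comultiplications are read off one leg at a time: a0 ⊗ a1 ⊗ a2 is the image
   of rho a = a0 ⊗ a' under comul a' = a1 ⊗ a2, and so on. *)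
Section Cowreath.
Context (k : fieldType) (H : hopfAlgType k) (A : algType k).
Context (rho : A -> A ⊗ H).

Record casimir_morphism (B : H ⊗ H -> A ⊗ H) : Prop := {
  casimir_linear : linear B;
  casimir_bimodule : forall (a : A) (g h h' : H),
    \sw_(a0 ⊗ a' <- rho a) \sw_(a1 ⊗ a2 <- comul a')
    \sw_(g1 ⊗ g' <- comul g) \sw_(g2 ⊗ g3 <- comul g')
      ((a0 ⊗ 1) * B ((g2 * h * a1) ⊗ (g3 * h' * a2)) * (1 ⊗ g1)) =
    (1 ⊗ g) * B (h ⊗ h') * (a ⊗ 1);
  casimir_comodule : forall h h' : H,
    \sw_(h1 ⊗ h2 <- comul h) \sw_(b ⊗ l <- B (h2 ⊗ h'))
    \sw_(b0 ⊗ b1 <- rho b) \sw_(l1 ⊗ l2 <- comul l)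
      (b0 ⊗ l1 ⊗ (l2 * h1 * b1)) =
    \sw_(h1 ⊗ h2 <- comul h') (B (h ⊗ h1) ⊗ h2)
}.

Definition normalized_casimir_morphism (B : H ⊗ H -> A ⊗ H) : Prop :=
  casimir_morphism B /\ forall h, B (comul h) = counit h *: (1 ⊗ 1).

(* Sinv stands for the inverse of the antipode. *)
Record integral (Sinv : H -> H) (T : H -> A ⊗ H) : Prop := {
  integral_linear : linear T;
  integral_comodule : forall h : H,
    \sw_(h1 ⊗ h2 <- comul h) \sw_(b ⊗ l <- T h2)
    \sw_(b0 ⊗ b1 <- rho b) \sw_(l1 ⊗ l2 <- comul l)
      (b0 ⊗ l1 ⊗ (l2 * h1 * b1)) =
    T h ⊗ 1;
  integral_bimodule : forall (a : A) (h : H),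
    \sw_(a0 ⊗ a' <- rho a) \sw_(a1 ⊗ a'' <- comul a')
    \sw_(a2 ⊗ a3 <- comul a'')
      ((a0 ⊗ 1) * T (Sinv a2 * h * a1) * (1 ⊗ Sinv a3)) =
    \sw_(a0 ⊗ a1 <- rho a) ((1 ⊗ Sinv a1) * T h * (a0 ⊗ 1))
}.

Definition total_integral (Sinv : H -> H) (T : H -> A ⊗ H) : Prop :=
  integral Sinv T /\ T 1 = 1 ⊗ 1.

End Cowreath.

(* Main.v *)
(* The antipode S is an anti-morphism of algebras and of coalgebras, by
   uniqueness of convolution inverses, hence so is its inverse S^-1, which
   moreover satisfies h2 S^-1(h1) = eps(h) 1 = S^-1(h2) h1.  After coassociativity
   brings the adjacent Sweedler legs together, each axiom reduces to these two
   cancellations; the comodule axiom of the integral is the one of the Casimir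
   morphism at h' = 1. *)

Require Import Defs.
From mathcomp Require Import all_boot all_order all_algebra.

Set Implicit Arguments.
Unset Strict Implicit.
Unset Printing Implicit Defensive.

Import GRing.Theory.
Local Open Scope ring_scope.

(** * Linearity of maps built from Sweedler sums *)

Section Linear.
Context (k : fieldType).

Lemma linear_compose (U V W : lmodType k) (f : V -> W) (g : U -> V) :
  linear f -> linear g -> linear (fun x => f (g x)).
Proof. by move=> lf lg c x y; rewrite lg lf. Qed.

Lemma linear_tensl (U V W : lmodType k) (f : U -> V) (w : W) :
  linear f -> linear (fun x => f x ⊗ w).
Proof. exact: (linear_compose (tensPl w)). Qed.

Lemma linear_tensr (U V W : lmodType k) (v : V) (f : U -> W) :
  linear f -> linear (fun x => v ⊗ f x).
Proof. exact: (linear_compose (tensPr v)). Qed.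

Lemma linear_mull (U : lmodType k) (R : algType k) (f : U -> R) (b : R) :
  linear f -> linear (fun x => f x * b).
Proof. by move=> lf c x y; rewrite lf mulrDl scalerAl. Qed.

Lemma linear_mulr (U : lmodType k) (R : algType k) (b : R) (f : U -> R) :
  linear f -> linear (fun x => b * f x).
Proof. by move=> lf c x y; rewrite lf mulrDr scalerAr. Qed.

Lemma linear_scaler (U V : lmodType k) (c : k) (f : U -> V) :
  linear f -> linear (fun x => c *: f x).
Proof. by move=> lf d x y; rewrite lf scalerDr !scalerA mulrC. Qed.

Lemma linear_scalel (U V : lmodType k) (f : U -> k) (v : V) :
  scalar f -> linear (fun x => f x *: v).
Proof. by move=> lf c x y; rewrite lf scalerDl scalerA. Qed.

Lemma bilinear_intro (U V W : lmodType k) (f : V -> W -> U) :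
  (forall w, linear (fun v => f v w)) -> (forall v, linear (fun w => f v w)) ->
  bilinear_for *:%R *:%R f.
Proof. by []. Qed.

Lemma linear_cancel (U V : lmodType k) (f : U -> V) (g : V -> U) :
  linear f -> cancel f g -> cancel g f -> linear g.
Proof. by move=> lf fK gK c x y; apply: (can_inj fK); rewrite lf !gK. Qed.

Lemma linear_at0 (U V : lmodType k) (f : U -> V) : linear f -> f 0 = 0.
Proof.
by move=> lf; have := lf (-1) 0 0; rewrite scaler0 addr0 scaleN1r addNr.
Qed.

Lemma linear_scale (U V : lmodType k) (f : U -> V) c x :
  linear f -> f (c *: x) = c *: f x.
Proof. by move=> lf; rewrite -[c *: x]addr0 lf linear_at0 // addr0. Qed.

Section Sweedler.
Context (U V W : lmodType k).
Implicit Types (f g : V -> W -> U) (t : V ⊗ W).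

(** Both sides run over the same chosen expression of [t], so this is a termwise equality of finite
    sums. It serves throughout to rewrite under a Sweedler sum. *)
Lemma eq_sweedler f g t :
  (forall v w, f v w = g v w) -> sweedler f t = sweedler g t.
Proof.
by move=> fg; rewrite sweedler.unlock; apply: eq_bigr => p _; rewrite fg.
Qed.

Lemma linear_sweedler_body (X : lmodType k) (f : X -> V -> W -> U) t :
  (forall v w, linear (fun x => f x v w)) ->
  linear (fun x => sweedler (f x) t).
Proof.
move=> lf c x y; rewrite sweedler.unlock scaler_sumr -big_split /=.
by apply: eq_bigr => p _; rewrite lf scalerDr !scalerA mulrC.
Qed.

Lemma linear_sweedler_arg (X : lmodType k) f (g : X -> V ⊗ W) :
  bilinear_for *:%R *:%R f -> linear g -> linear (fun x => sweedler f (g x)).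
Proof. by move=> /sweedler_linear; apply: linear_compose. Qed.

Lemma sweedler_map (X : lmodType k) (L : U -> X) f t :
  linear L -> L (sweedler f t) = \sw_(v ⊗ w <- t) L (f v w).
Proof.
move=> lL; rewrite sweedler.unlock (@big_morph _ _ L 0 +%R) ?linear_at0 //.
  by apply: eq_bigr => p _; rewrite linear_scale.
by move=> x y; rewrite -[x]scale1r lL !scale1r.
Qed.

Lemma sweedler_tens (t : V ⊗ W) : \sw_(v ⊗ w <- t) (v ⊗ w) = t.
Proof.
have tens_bilinear := tens_is_bilinear V W.
elim/tensor_ind: t => [v w|s t IHs IHt]; first by rewrite sweedlerE.
by rewrite sweedlerD // IHs IHt.
Qed.

Lemma exchange_sweedler (X Y : lmodType k) (s : X ⊗ Y) t
    (f : X -> Y -> V -> W -> U) :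
  \sw_(x ⊗ y <- s) \sw_(v ⊗ w <- t) f x y v w =
  \sw_(v ⊗ w <- t) \sw_(x ⊗ y <- s) f x y v w.
Proof.
rewrite sweedler.unlock; under eq_bigr do rewrite scaler_sumr.
rewrite exchange_big; apply: eq_bigr => p _; rewrite scaler_sumr.
by apply: eq_bigr => q _; rewrite !scalerA mulrC.
Qed.

End Sweedler.

Lemma sweedlerM (A B : algType k) (U : lmodType k) (f : A -> B -> U)
    (s t : A ⊗ B) :
  bilinear_for *:%R *:%R f ->
  sweedler f (s * t) =
  \sw_(a ⊗ b <- s) \sw_(a' ⊗ b' <- t) f (a * a') (b * b').
Proof.
move=> fb; have lf := sweedler_linear fb.
rewrite -[s * t]/(tensor_mul s t) tensor_mul.unlock sweedler_map //.
apply: eq_sweedler => a b; rewrite sweedler_map //.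
by apply: eq_sweedler => a' b'; rewrite sweedlerE.
Qed.

End Linear.

(* Automation of linearity side conditions *)
Create HintDb linear.
#[local] Hint Extern 0 (GRing.linear_for _ comul) => exact: comul_linear : linear.
#[local] Hint Extern 0 (GRing.linear_for _ counit) => exact: counit_scalar : linear.
#[local] Hint Extern 0 (GRing.linear_for _ antipode) => exact: antipode_linear : linear.

(* [match], not [lazymatch]: in the pattern of the sweedler cases the
   metavariable standing for a constant can also match a term that depends on
   [x], an error from which only [match] recovers by trying the next case. *)
Ltac lin := cbv beta; match goal with
  | |- bilinear_for _ _ _ => apply bilinear_intro; intros ?; lin
  | |- GRing.linear_for _ (fun x => x) => by []
  | |- GRing.linear_for _ (fun x => sweedler (@?f x) ?t) =>
      refine (@linear_sweedler_body _ _ _ _ _ f t _); intros ? ?; lin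
  | |- GRing.linear_for _ (fun x => sweedler ?f (@?g x)) =>
      refine (@linear_sweedler_arg _ _ _ _ _ f g _ _); lin
  | |- GRing.linear_for _ (fun x => (@?f x) ⊗ ?w) =>
      refine (@linear_tensl _ _ _ _ f w _); lin
  | |- GRing.linear_for _ (fun x => ?v ⊗ (@?f x)) =>
      refine (@linear_tensr _ _ _ _ v f _); lin
  | |- GRing.linear_for _ (fun x => (@?f x) * ?w) =>
      refine (@linear_mull _ _ _ f w _); lin
  | |- GRing.linear_for _ (fun x => ?v * (@?f x)) =>
      refine (@linear_mulr _ _ _ v f _); lin
  | |- GRing.linear_for _ (fun x => ?v *: (@?f x)) =>
      refine (@linear_scaler _ _ _ v f _); lin
  | |- GRing.linear_for _ (fun x => (@?f x) *: ?v) =>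
      refine (@linear_scalel _ _ _ f v _); auto with linear
  | |- GRing.linear_for _ ?f => solve [auto with linear]
  | |- GRing.linear_for _ (fun x => ?f (@?g x)) =>
      refine (@linear_compose _ _ _ _ f g _ _);
      [solve [auto with linear] | lin]
  end.

(** * The antipode reverses products and coproducts *)

Section Hopf.
Context (k : fieldType) (H : hopfAlgType k).
Local Notation S := (antipode : H -> H).

Section Maps.
Context (U : lmodType k).

(** A trilinear [F] induces a linear map [G] on the left-nested triple tensor product; applying [G]
    to [comulA] gives the equality. The hypotheses on [F] follow that nesting: the first two legs
    together, then the third. *)
Lemma comul_coassoc (F : H -> H -> H -> U) (h : H) :
  (forall c, bilinear_for *:%R *:%R (fun a b => F a b c)) ->
  (forall a b, linear (F a b)) ->
  \sw_(x ⊗ c <- comul h) \sw_(a ⊗ b <- comul x) F a b c =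
  \sw_(a ⊗ y <- comul h) \sw_(b ⊗ c <- comul y) F a b c.
Proof.
move=> F12 F3.
have F1 b c : linear (fun a => F a b c) := (F12 c).1 b.
have F2 a c : linear (fun b => F a b c) := (F12 c).2 a.
pose G t := \sw_(x ⊗ c <- t) \sw_(a ⊗ b <- x) F a b c.
have Gb : bilinear_for *:%R *:%R (fun x c => \sw_(a ⊗ b <- x) F a b c) by lin.
have lG : linear G by rewrite /G; lin.
have /(congr1 G) := comulA h.
rewrite sweedler_map // [RHS]sweedler_map // => GE.
transitivity (\sw_(x ⊗ c <- comul h) G (comul x ⊗ c)).
  by apply: eq_sweedler => x c; rewrite /G sweedlerE.
rewrite GE; apply: eq_sweedler => a y; rewrite sweedler_map //.
by apply: eq_sweedler => b c; rewrite /G !sweedlerE.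
Qed.

Context (L : H -> U) (lL : linear L).

(** This and the next three lemmas put the counit and antipode axioms under a linear context [L], so
    that legs cancel deep inside an expression. Read from right to left, the counit versions insert
    a comultiplication. *)
Lemma counitl_map h : \sw_(a ⊗ b <- comul h) counit a *: L b = L h.
Proof.
rewrite -[in RHS](counitl h) sweedler_map //.
by apply: eq_sweedler => a b; rewrite linear_scale.
Qed.

Lemma counitr_map h : \sw_(a ⊗ b <- comul h) counit b *: L a = L h.
Proof.
rewrite -[in RHS](counitr h) sweedler_map //.
by apply: eq_sweedler => a b; rewrite linear_scale.
Qed.

Lemma antipodel_map h :
  \sw_(a ⊗ b <- comul h) L (S a * b) = counit h *: L 1.
Proof. by rewrite -(sweedler_map _ _ lL) antipodel linear_scale. Qed.

Lemma antipoder_map h :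
  \sw_(a ⊗ b <- comul h) L (a * S b) = counit h *: L 1.
Proof. by rewrite -(sweedler_map _ _ lL) antipoder linear_scale. Qed.

End Maps.

Lemma comul1 : comul (1 : H) = 1 ⊗ 1.
Proof. exact: (comul_monoid_morphism : monoid_morphism (comul : H -> _)).1. Qed.

Lemma comulM (g h : H) : comul (g * h) = comul g * comul h.
Proof. exact: (comul_monoid_morphism : monoid_morphism (comul : H -> _)).2. Qed.

Lemma counit1 : counit (1 : H) = 1.
Proof. exact: (counit_monoid_morphism : monoid_morphism (counit : H -> k)).1. Qed.

Lemma counitM (g h : H) : counit (g * h) = counit g * counit h.
Proof. exact: (counit_monoid_morphism : monoid_morphism (counit : H -> k)).2. Qed.

Lemma antipode1 : S 1 = 1.
Proof.
have := antipodel (1 : H).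
by rewrite comul1 sweedlerE ?mulr1 ?counit1 ?scale1r //; lin.
Qed.

(* Both sides evaluate the sum of S(h1 g1) h2 g2 S(g3) S(h3). *)
Lemma antipodeM (h g : H) : S (h * g) = S g * S h.
Proof.
pose E a b c p q r := S (a * p) * (b * q) * (S r * S c).
transitivity (\sw_(x ⊗ c <- comul h) \sw_(a ⊗ b <- comul x)
  \sw_(y ⊗ r <- comul g) \sw_(p ⊗ q <- comul y) E a b c p q r); last first.
  transitivity (\sw_(x ⊗ c <- comul h) counit x *: (S g * S c)); last first.
    by apply: (@counitl_map _ (fun c => S g * S c)); lin.
  apply: eq_sweedler => x c; rewrite exchange_sweedler.
  transitivity (\sw_(y ⊗ r <- comul g) counit y *: (counit x *: (S r * S c))).
    apply: eq_sweedler => y r; rewrite /E.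
    rewrite -(@sweedlerM _ _ _ _ (fun u v => S u * v * (S r * S c))); last by lin.
    rewrite -comulM (@antipodel_map _ (fun z => z * (S r * S c))); last by lin.
    by rewrite mul1r counitM scalerA mulrC.
  by apply: (@counitl_map _ (fun r => counit x *: (S r * S c))); lin.
(* The other bracketing cancels from the inside: first [q * S r] coming from [g], then [b * S c]
   coming from [h]. *)
rewrite comul_coassoc; [|by move=> c; rewrite /E; lin|by move=> a b; rewrite /E; lin].
transitivity (\sw_(a ⊗ w <- comul h) counit w *: S (a * g)).
  by rewrite (@counitr_map _ (fun a => S (a * g))) //; lin.
apply: eq_sweedler => a w.
transitivity (\sw_(b ⊗ c <- comul w) (S (a * g) * (b * S c))).
  rewrite (@antipoder_map _ (fun z => S (a * g) * z)); last by lin.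
  by rewrite mulr1.
apply: eq_sweedler => b c.
rewrite comul_coassoc; [|by move=> r; rewrite /E; lin|by move=> p q; rewrite /E; lin].
rewrite -(@counitr_map _ (fun p => S (a * p) * (b * S c))); last by lin.
apply: eq_sweedler => p z.
transitivity (\sw_(q ⊗ r <- comul z) (S (a * p) * (b * ((q * S r) * S c)))).
  rewrite (@antipoder_map _ (fun y => S (a * p) * (b * (y * S c)))); last by lin.
  by rewrite mul1r.
by apply: eq_sweedler => q r; rewrite /E !mulrA.
Qed.

(** The flipped map sending h to S(h2) ⊗ S(h1) is a right convolution inverse of [comul]: the sum is
    h1 S(h4) ⊗ h2 S(h3), where the inner pair h2 S(h3) cancels first and the outer pair then becomes
    adjacent. *)
Lemma comul_antipode_inverse (h : H) :
  \sw_(b ⊗ z <- comul h) (comul b * \sw_(r ⊗ s <- comul z) (S s ⊗ S r)) =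
  counit h *: 1.
Proof.
pose E p q r s := (p * S s) ⊗ (q * S r).
transitivity (\sw_(b ⊗ z <- comul h) \sw_(p ⊗ q <- comul b)
              \sw_(r ⊗ s <- comul z) E p q r s).
  apply: eq_sweedler => b z.
  rewrite (@sweedler_map _ _ _ _ _ (fun t => comul b * t)); last by lin.
  rewrite exchange_sweedler; apply: eq_sweedler => r s.
  rewrite -[in LHS](sweedler_tens (comul b)).
  rewrite (@sweedler_map _ _ _ _ _ (fun t => t * (S s ⊗ S r))); last by lin.
  by apply: eq_sweedler => p q; rewrite tensM.
rewrite comul_coassoc; [|by move=> z; rewrite /E; lin|by move=> p q; rewrite /E; lin].
transitivity (\sw_(p ⊗ w <- comul h) ((p * S w) ⊗ (1 : H))); last first.
  by rewrite (@antipoder_map _ (fun x => x ⊗ 1)) ?tens1 //; lin.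
apply: eq_sweedler => p w.
rewrite -comul_coassoc; [|by move=> z; rewrite /E; lin|by move=> q r; rewrite /E; lin].
rewrite -(@counitl_map _ (fun w => (p * S w) ⊗ 1)); last by lin.
apply: eq_sweedler => v s.
by rewrite /E (@antipoder_map _ (fun x => (p * S s) ⊗ x)) //; lin.
Qed.

(** As [comul] is multiplicative, its composite with S is a left convolution inverse of it, while
    [R] is a right one. Evaluating the convolution of the three maps in both bracketings identifies
    them. *)
Lemma comul_antipode (h : H) :
  comul (S h) = \sw_(a ⊗ b <- comul h) (S b ⊗ S a).
Proof.
pose R (h : H) := \sw_(a ⊗ b <- comul h) (S b ⊗ S a).
rewrite -/(R h); pose E a b z := comul (S a) * (comul b * R z).
transitivity (\sw_(x ⊗ z <- comul h) \sw_(a ⊗ b <- comul x) E a b z).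
  rewrite comul_coassoc;
    [|by move=> z; rewrite /E; lin|by move=> a b; rewrite /E /R; lin].
  rewrite -(@counitr_map _ (fun a => comul (S a))); last by lin.
  apply: eq_sweedler => a y.
  rewrite -(@sweedler_map _ _ _ _ _ (fun t => comul (S a) * t)); last by lin.
  by rewrite comul_antipode_inverse -scalerAr mulr1.
rewrite -(@counitl_map _ R); last by rewrite /R; lin.
apply: eq_sweedler => x z.
transitivity (\sw_(a ⊗ b <- comul x) (comul (S a * b) * R z)).
  by apply: eq_sweedler => a b; rewrite /E comulM mulrA.
rewrite (@antipodel_map _ (fun y => comul y * R z)); last by lin.
by rewrite comul1 tens1 mul1r.
Qed.

End Hopf.

(** * The inverse of the antipode *)

Section InverseAntipode.
Context (k : fieldType) (H : hopfAlgType k) (Sinv : H -> H).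
Local Notation S := (antipode : H -> H).
Context (antipodeK : cancel S Sinv) (SinvK : cancel Sinv S).

Lemma Sinv_linear : linear Sinv.
Proof. by apply: linear_cancel antipodeK SinvK; lin. Qed.

Local Hint Resolve Sinv_linear : linear.

Lemma Sinv1 : Sinv 1 = 1.
Proof. by rewrite -[RHS]antipodeK antipode1. Qed.

Lemma SinvM (h g : H) : Sinv (h * g) = Sinv g * Sinv h.
Proof. by apply: (can_inj antipodeK); rewrite antipodeM !SinvK. Qed.

(** Writing h as [S (Sinv h)] on the right, [comul_antipode] flips the legs of [comul (Sinv h)] and
    applies S to each; the second flip and [Sinv] undo this. *)
Lemma comul_Sinv (h : H) :
  comul (Sinv h) = \sw_(a ⊗ b <- comul h) (Sinv b ⊗ Sinv a).
Proof.
rewrite -[in RHS](SinvK h) comul_antipode.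
rewrite (@sweedler_map _ _ _ _ _
  (fun t => \sw_(a ⊗ b <- t) (Sinv b ⊗ Sinv a))); last by lin.
rewrite -[LHS]sweedler_tens; apply: eq_sweedler => a b.
by rewrite sweedlerE ?antipodeK //; lin.
Qed.

(** The injective map S sends S^-1(h2) h1 to S(h1) h2, which reduces the claim to [antipodel]. *)
Lemma Sinv_mull (U : lmodType k) (L : H -> U) (h : H) : linear L ->
  \sw_(a ⊗ b <- comul h) L (Sinv b * a) = counit h *: L 1.
Proof.
move=> lL; rewrite -(sweedler_map _ _ lL) -linear_scale //; congr L.
apply: (can_inj antipodeK); rewrite (sweedler_map _ _ (@antipode_linear _ H)).
rewrite linear_scale ?antipode1 -?antipodel; last by lin.
by apply: eq_sweedler => a b; rewrite antipodeM SinvK.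
Qed.

(** Here S sends h2 S^-1(h1) to h1 S(h2), so [antipoder] applies. *)
Lemma Sinv_mulr (U : lmodType k) (L : H -> U) (h : H) : linear L ->
  \sw_(a ⊗ b <- comul h) L (b * Sinv a) = counit h *: L 1.
Proof.
move=> lL; rewrite -(sweedler_map _ _ lL) -linear_scale //; congr L.
apply: (can_inj antipodeK); rewrite (sweedler_map _ _ (@antipode_linear _ H)).
rewrite linear_scale ?antipode1 -?antipoder; last by lin.
by apply: eq_sweedler => a b; rewrite antipodeM SinvK.
Qed.

End InverseAntipode.

(** * The canonical Casimir morphism and its total integral *)

Definition canonical_casimir (k : fieldType) (H : hopfAlgType k) (A : algType k)
    (Sinv : H -> H) (t : H ⊗ H) : A ⊗ H :=
  \sw_(h ⊗ h' <- t) (1 ⊗ (h' * Sinv h)).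

Section Canonical.
Context (k : fieldType) (H : hopfAlgType k) (A : algType k).
Context (rho : A -> A ⊗ H) (rho_coaction : comodule_algebra rho).
Context (Sinv : H -> H) (antipodeK : cancel (antipode : H -> H) Sinv).
Context (SinvK : cancel Sinv (antipode : H -> H)).

Let lSinv : linear Sinv := Sinv_linear antipodeK SinvK.
Let lrho : linear rho := coaction_linear rho_coaction.
Local Hint Resolve lSinv lrho : linear.

Local Notation B := (canonical_casimir A Sinv).

Lemma canonical_casimir_bilinear :
  bilinear_for *:%R *:%R (fun h h' : H => 1 ⊗ (h' * Sinv h) : A ⊗ H).
Proof. by lin. Qed.

Lemma canonical_casimir_linear : linear B.
Proof. exact: sweedler_linear canonical_casimir_bilinear. Qed.

Local Hint Resolve canonical_casimir_linear : linear.

Lemma canonical_casimirE h h' : B (h ⊗ h') = 1 ⊗ (h' * Sinv h).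
Proof. exact: sweedlerE canonical_casimir_bilinear _ _. Qed.

Lemma coaction1 : rho 1 = 1 ⊗ 1.
Proof. exact: (coaction_monoid_morphism rho_coaction).1. Qed.

Lemma coaction_counit_map (U : lmodType k) (L : A -> U) a : linear L ->
  \sw_(a0 ⊗ a1 <- rho a) counit a1 *: L a0 = L a.
Proof.
move=> lL; rewrite -[in RHS](coaction_counit rho_coaction a) sweedler_map //.
by apply: eq_sweedler => a0 a1; rewrite linear_scale.
Qed.

(** The left side is a0 ⊗ g3 h' (a2 S^-1(a1)) S^-1(h) (S^-1(g2) g1), in which both bracketed
    products cancel. *)
Lemma canonical_casimir_bimodule (a : A) (g h h' : H) :
  \sw_(a0 ⊗ a' <- rho a) \sw_(a1 ⊗ a2 <- comul a')
  \sw_(g1 ⊗ g' <- comul g) \sw_(g2 ⊗ g3 <- comul g')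
    ((a0 ⊗ 1) * B ((g2 * h * a1) ⊗ (g3 * h' * a2)) * (1 ⊗ g1)) =
  (1 ⊗ g) * B (h ⊗ h') * (a ⊗ 1).
Proof.
rewrite canonical_casimirE !tensM !mul1r mulr1.
(* Expanding a as eps(a') a0 makes both sides sums over [rho a]; the scalar is then realised as a2
   S^-1(a1). *)
rewrite -(@coaction_counit_map _ (fun a => a ⊗ (g * (h' * Sinv h)))); last by lin.
apply: eq_sweedler => a0 a'.
transitivity (\sw_(a1 ⊗ a2 <- comul a')
    (a0 ⊗ (g * (h' * ((a2 * Sinv a1) * Sinv h))))); last first.
  rewrite (@Sinv_mulr _ _ _ antipodeK SinvK _
    (fun z => a0 ⊗ (g * (h' * (z * Sinv h))))); last by lin.
  by rewrite mul1r.
apply: eq_sweedler => a1 a2; set X := h' * (_ * _).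
transitivity (\sw_(g1 ⊗ g' <- comul g) \sw_(g2 ⊗ g3 <- comul g')
    (a0 ⊗ (g3 * (X * (Sinv g2 * g1))))).
  apply: eq_sweedler => g1 g'; apply: eq_sweedler => g2 g3.
  by rewrite canonical_casimirE !tensM !mulr1 !(SinvM antipodeK SinvK) mul1r /X !mulrA.
(* Now g1 and g2 become the legs of a single comultiplication, ready to cancel; [X] does not involve
   g. *)
rewrite -comul_coassoc; [|by move=> c; lin|by move=> b c; lin].
rewrite -(@counitl_map _ _ _ (fun g => a0 ⊗ (g * X))); last by lin.
apply: eq_sweedler => y g3.
rewrite (@Sinv_mull _ _ _ antipodeK SinvK _
  (fun z => a0 ⊗ (g3 * (X * z)))); last by lin.
by rewrite mulr1.
Qed.

(** Since rho(1) = 1 ⊗ 1 and S^-1 flips coproducts, the left side is 1 ⊗ h'1 S^-1(h3) ⊗ h'2 S^-1(h2)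
    h1, and S^-1(h2) h1 cancels. *)
Lemma canonical_casimir_comodule (h h' : H) :
  \sw_(h1 ⊗ h2 <- comul h) \sw_(b ⊗ l <- B (h2 ⊗ h'))
  \sw_(b0 ⊗ b1 <- rho b) \sw_(l1 ⊗ l2 <- comul l)
    (b0 ⊗ l1 ⊗ (l2 * h1 * b1)) =
  \sw_(h1 ⊗ h2 <- comul h') (B (h ⊗ h1) ⊗ h2).
Proof.
pose E p q h1 r s : A ⊗ H ⊗ H := 1 ⊗ (p * Sinv s) ⊗ (q * (Sinv r * h1)).
transitivity (\sw_(h1 ⊗ h2 <- comul h) \sw_(p ⊗ q <- comul h')
              \sw_(r ⊗ s <- comul h2) E p q h1 r s).
  apply: eq_sweedler => h1 h2; rewrite canonical_casimirE sweedlerE; last by lin.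
  rewrite coaction1 sweedlerE; last by lin.
  rewrite comulM sweedlerM; last by lin.
  apply: eq_sweedler => p q; rewrite (comul_Sinv antipodeK SinvK).
  rewrite (@sweedler_map _ _ _ _ _ (fun t =>
    \sw_(a' ⊗ b' <- t) (1 ⊗ (p * a') ⊗ (q * b' * h1 * 1)))); last by lin.
  apply: eq_sweedler => r s; rewrite sweedlerE; last by lin.
  by rewrite /E mulr1 mulrA.
rewrite exchange_sweedler; apply: eq_sweedler => p q.
rewrite -comul_coassoc; [|by move=> c; rewrite /E; lin|by move=> a b; rewrite /E; lin].
rewrite canonical_casimirE
  -(@counitl_map _ _ _ (fun h => 1 ⊗ (p * Sinv h) ⊗ q)); last by lin.
apply: eq_sweedler => y s.
rewrite /E (@Sinv_mull _ _ _ antipodeK SinvK _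
  (fun z => 1 ⊗ (p * Sinv s) ⊗ (q * z))); last by lin.
by rewrite mulr1.
Qed.

Lemma canonical_casimir_normalized h : B (comul h) = counit h *: (1 ⊗ 1).
Proof.
rewrite /canonical_casimir.
by rewrite (@Sinv_mulr _ _ _ antipodeK SinvK _ (fun z => 1 ⊗ z)) //; lin.
Qed.

Lemma canonical_integral_comodule (h : H) :
  \sw_(h1 ⊗ h2 <- comul h) \sw_(b ⊗ l <- 1 ⊗ Sinv h2)
  \sw_(b0 ⊗ b1 <- rho b) \sw_(l1 ⊗ l2 <- comul l)
    (b0 ⊗ l1 ⊗ (l2 * h1 * b1)) =
  1 ⊗ Sinv h ⊗ 1.
Proof.
transitivity (\sw_(h1 ⊗ h2 <- comul 1) (B (h ⊗ h1) ⊗ h2)).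
  rewrite -canonical_casimir_comodule; apply: eq_sweedler => h1 h2.
  by rewrite canonical_casimirE mul1r.
by rewrite comul1 sweedlerE ?canonical_casimirE ?mul1r //; lin.
Qed.

(** The H-leg on the left is S^-1(a1) S^-1(h) S^-1(a3 S^-1(a2)), because S^-1 reverses products; the
    last factor collapses to a counit, which [counitr_map] absorbs. *)
Lemma canonical_integral_bimodule (a : A) (h : H) :
  \sw_(a0 ⊗ a' <- rho a) \sw_(a1 ⊗ a'' <- comul a')
  \sw_(a2 ⊗ a3 <- comul a'')
    ((a0 ⊗ 1) * (1 ⊗ Sinv (Sinv a2 * h * a1)) * (1 ⊗ Sinv a3)) =
  \sw_(a0 ⊗ a1 <- rho a) ((1 ⊗ Sinv a1) * (1 ⊗ Sinv h) * (a0 ⊗ 1)).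
Proof.
apply: eq_sweedler => a0 a'; rewrite !tensM !mul1r mulr1.
rewrite -(@counitr_map _ _ _ (fun x => a0 ⊗ (Sinv x * Sinv h))); last by lin.
apply: eq_sweedler => a1 a''.
transitivity (\sw_(a2 ⊗ a3 <- comul a'')
    (a0 ⊗ (Sinv a1 * (Sinv h * Sinv (a3 * Sinv a2))))).
  apply: eq_sweedler => a2 a3.
  by rewrite !tensM !mulr1 mul1r !(SinvM antipodeK SinvK) !mulrA.
rewrite (@Sinv_mulr _ _ _ antipodeK SinvK _
  (fun z => a0 ⊗ (Sinv a1 * (Sinv h * Sinv z)))); last by lin.
by rewrite (Sinv1 antipodeK) mulr1.
Qed.

End Canonical.

(** The first conjunct certifies that the Sweedler sum defining [B] has the intended value on pure
    tensors; the third records the correspondence between [B] and [T]. *)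
Theorem proposition3p4 (k : fieldType) (H : hopfAlgType k) (A : algType k)
    (rho : A -> A ⊗ H) (rho_coaction : comodule_algebra rho)
    (Sinv : H -> H) (antipodeK : cancel (antipode : H -> H) Sinv)
    (SinvK : cancel Sinv (antipode : H -> H)) :
  let B : H ⊗ H -> A ⊗ H :=
    fun t => \sw_(h ⊗ h' <- t) (1 ⊗ (h' * Sinv h)) in
  let T : H -> A ⊗ H := fun h => 1 ⊗ Sinv h in
  [/\ forall h h' : H, B (h ⊗ h') = 1 ⊗ (h' * Sinv h),
      normalized_casimir_morphism rho B,
      forall h : H, T h = B (h ⊗ 1) &
      total_integral rho Sinv T].
Proof.
move=> B T; have BE := canonical_casimirE A antipodeK SinvK.
split; [exact: BE | split | by move=> h; rewrite [RHS]BE mul1r | split].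
- split; first exact: canonical_casimir_linear antipodeK SinvK.
    exact (canonical_casimir_bimodule rho_coaction antipodeK SinvK).
  exact (canonical_casimir_comodule rho_coaction antipodeK SinvK).
- exact: canonical_casimir_normalized antipodeK SinvK.
- split; first exact: linear_tensr (Sinv_linear antipodeK SinvK).
    exact (canonical_integral_comodule rho_coaction antipodeK SinvK).
  exact (canonical_integral_bimodule rho antipodeK SinvK).
- by rewrite /T (Sinv1 antipodeK).
Qed.
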